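(* There exist universal constants $\bar c,\hat c>0$ such that the following holds. Let $\omega\ge 0$, $L,\delta^0,\varepsilon>0$ and an integer $n\ge 2$ be any numbers such that $\bar c\,\varepsilon< L\delta^0$. Then for any zero-respecting algorithm $A\in\mathcal A_{\rm zr}$ there exist a dimension $d$, a function $f:\mathbb R^d\to\mathbb R$ with $f\in\mathcal F_{\delta^0,L}$, differentiable functions $f_1,\dots,f_n:\mathbb R^d\to\mathbb R$ with $f=\frac1n\sum_{i=1}^n f_i$, and i.i.d. unbiased compressors $\mathcal C_1,\dots,\mathcal C_n\in\mathbb U(\omega)$ on $\mathbb R^d$, such that the points $x^k$ produced by the Compressed Protocol (described in the context) run with $f_1,\dots,f_n$, $A$ and $\mathcal C_1,\dots,\mathcal C_n$ satisfy $$\mathbb E\left[\|\nabla f(x^k)\|^2\right]>\varepsilon\quad\text{for all integers } 0\le k\le \hat c\,\frac{(\omega+1)L\delta^0}{\varepsilon}.$$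
   Context: $\|\cdot\|$ is the Euclidean norm; $[n]=\{1,\dots,n\}$; $\mathrm{supp}(x)=\{i: x_i\ne 0\}$; an empty union is $\emptyset$. Function class: $\mathcal F_{\delta^0,L}$ is the set of differentiable $f:\mathbb R^d\to\mathbb R$ (any $d$) with $\|\nabla f(x)-\nabla f(y)\|\le L\|x-y\|$ for all $x,y$ and $f(0)-\inf_x f(x)\le\delta^0$. Unbiased compressors: a random mapping $\mathcal C:\mathbb R^d\to\mathbb R^d$ is in $\mathbb U(\omega)$ if $\mathbb E[\mathcal C(x)]=x$ and $\mathbb E\|\mathcal C(x)-x\|^2\le\omega\|x\|^2$ for all $x\in\mathbb R^d$. All calls of the compressors (for different iterations and different $i$) use independent randomness. Compressed Protocol: given $f_1,\dots,f_n$, an algorithm $A=\{(B_1^k,B_{2,1}^k,\dots,B_{2,n}^k,L_1^k,\dots,L_n^k)\}_{k\ge0}$ and compressors $\mathcal C_1,\dots,\mathcal C_n$, for $k=0,1,2,\dots$: (1) the server computes $x^k=B_1^k(g_1^1,\dots,g_1^k,\dots,g_n^1,\dots,g_n^k)$; (2) the server computes $s_i^k=B_{2,i}^k(g_1^1,\dots,g_1^k,\dots,g_n^1,\dots,g_n^k)$ for $i\in[n]$; (3) the server sends $\bar s_i^k=\mathcal C_i(s_i^k)$ to worker $i$, for each $i\in[n]$; (4) worker $i$ computes $g_i^{k+1}=L_i^k(\bar s_i^0,\dots,\bar s_i^k)$, where $L_i^k$ has access to the gradient oracle of $f_i$ (may call $\nabla f_i$ arbitrarily many times subject to the support rule below),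 and sends $g_i^{k+1}$ to the server. Zero-respecting algorithms: $A\in\mathcal A_{\rm zr}$ means that (for each dimension $d$) $A$ is a sequence of such tuples of deterministic mappings with $B_1^k,B_{2,i}^k:(\mathbb R^d)^{nk}\to\mathbb R^d$ for $k\ge1$, $B_1^0,B_{2,i}^0\in\mathbb R^d$, $L_i^k:(\mathbb R^d)^{k+1}\to\mathbb R^d$, and for all $k\ge0$, $i\in[n]$: $\mathrm{supp}(x^k)\subseteq\bigcup_{j=1}^k\bigcup_{l=1}^n\mathrm{supp}(g_l^j)$, $\mathrm{supp}(s_i^k)\subseteq\bigcup_{j=1}^k\bigcup_{l=1}^n\mathrm{supp}(g_l^j)$, and there are vectors $\hat g_{i,1}^{k+1},\hat g_{i,2}^{k+1},\dots$ with $\mathrm{supp}(\hat g_{i,m}^{k+1})\subseteq\bigcup_{j=0}^k\mathrm{supp}(\bar s_i^j)\cup\bigcup_{r=1}^{m-1}\mathrm{supp}(\nabla f_i(\hat g_{i,r}^{k+1}))$ for all $m\ge1$, such that $\mathrm{supp}(g_i^{k+1})\subseteq\bigcup_{m\ge1}\mathrm{supp}(\hat g_{i,m}^{k+1})$. *)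

(* Defs.v *)
From HB Require Import structures.
From mathcomp Require Import all_boot all_order all_algebra.
From mathcomp Require Import all_classical all_reals all_analysis.

Set Implicit Arguments.
Unset Strict Implicit.
Unset Printing Implicit Defensive.

Import Order.TTheory GRing.Theory Num.Theory.
Import numFieldNormedType.Exports.

Local Open Scope classical_set_scope.
Local Open Scope ring_scope.

Section function_class.
Context {R : realType} {d : nat}.
Implicit Types (x y : 'rV[R]_d) (f : 'rV[R]_d -> R).

(* The library norm on 'rV[R]_d is the sup norm. It defines the same notion of
   differentiability, but the quantitative bounds below are Euclidean. *)
Definition enorm x : R := Num.sqrt (\sum_(j < d) x 0 j ^+ 2).

Definition supp x : set 'I_d := [set j | x 0 j != 0].

(* The vector of partial derivatives: it is the gradient wherever f is
   differentiable. *)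
Definition grad f x : 'rV[R]_d := \row_(j < d) 'D_(delta_mx 0 j) f x.

(* The infimum is taken in \bar R, so that an f that is not bounded below is
   excluded by the last condition. *)
Definition smooth_class (delta0 L : R) f : Prop :=
  [/\ forall x, differentiable f x,
      forall x y, enorm (grad f x - grad f y) <= L * enorm (x - y) &
      ((f 0)%:E - ereal_inf (range (EFin \o f)) <= delta0%:E)%E].

End function_class.

Section randomness.
Context {R : realType}.

(* A random mapping is a map C(u, x) of a random seed u of law nu and of the
   input x, jointly measurable in (u, x). The sigma-algebra of R^d is that of
   d.-tuple R because the library has none on row vectors. *)
Definition random_mapping {dS} {S : measurableType dS} {d : nat}
    (C : S -> 'rV[R]_d -> 'rV[R]_d) : Prop :=
  forall j : 'I_d, measurable_fun [set: S * d.-tuple R]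
    (fun p => C p.1 (\row_(i < d) tnth p.2 i) 0 j).

(* U(omega). As the integral in the expectation of X is the difference, with
   oo - oo = -oo, of those of X^+ and X^-, the second condition includes the
   integrability of the coordinates of C(x). *)
Definition unbiased_compressor {dS} {S : measurableType dS} {d : nat}
    (nu : probability S R) (omega : R) (C : S -> 'rV[R]_d -> 'rV[R]_d) : Prop :=
  [/\ random_mapping C,
      forall x j, 'E_nu[fun u => C u x ord0 j]%E = (x 0 j)%:E &
      forall x, ('E_nu[fun u => (enorm (C u x - x) ^+ 2)%R]
                 <= (omega * enorm x ^+ 2)%:E)%E].

Definition mutually_independent {dO dS} {Omega : measurableType dO}
    {S : measurableType dS} (P : probability Omega R) {I : eqType}
    (X : I -> Omega -> S) : Prop :=
  forall (J : seq I) (B : I -> set S), uniq J -> (forall t, measurable (B t)) ->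
    P (\big[setI/setT]_(t <- J) (X t @^-1` B t))
    = (\big[*%E/1%E]_(t <- J) P (X t @^-1` B t))%E.

(* With seeds X_{(k, i)} of this kind, C(X_{(k, i)}, .) is the call at iteration
   k of the i-th of n i.i.d. compressors with the law of C. *)
Definition iid_seeds {dO dS} {Omega : measurableType dO}
    {S : measurableType dS} (P : probability Omega R) (nu : probability S R)
    {I : eqType} (X : I -> Omega -> S) : Prop :=
  [/\ forall t, measurable_fun [set: Omega] (X t),
      forall t B, measurable B -> P (X t @^-1` B) = nu B &
      mutually_independent P X].

End randomness.

(* B_1^k, B_{2,i}^k and L_i^k. The server maps take the matrix of messages
   whose entry (j, l) is g_l^{j+1}, j < k; for k = 0 they are constants.
   A worker map takes the gradient oracle and the tuple of the received vectors
   \bar s_i^0, ..., \bar s_i^k. *)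
Record algorithm (R : realType) (n d : nat) := Algorithm {
  server_point : forall k : nat,
    ('I_k -> 'I_n -> 'rV[R]_d) -> 'rV[R]_d;
  server_msg : forall k : nat, 'I_n ->
    ('I_k -> 'I_n -> 'rV[R]_d) -> 'rV[R]_d;
  worker_map : forall k : nat, 'I_n ->
    ('rV[R]_d -> 'rV[R]_d) -> ('I_k.+1 -> 'rV[R]_d) -> 'rV[R]_d
}.

Section protocol.
Context {R : realType} {n d : nat}.
(* c k i is the (realized) map by which the message s_i^k is compressed. *)
Variables (A : algorithm R n d) (f : 'I_n -> 'rV[R]_d -> R)
          (c : nat -> 'I_n -> 'rV[R]_d -> 'rV[R]_d).

(* The vectors g_i^{j+1} and \bar s_i^j, for j < k (and 0 for j >= k). *)
Fixpoint protocol_history (k : nat) :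
    (nat -> 'I_n -> 'rV[R]_d) * (nat -> 'I_n -> 'rV[R]_d) :=
  if k is k'.+1 then
    let: (g, sb) := protocol_history k' in
    let sb' j i :=
      if j == k' then c k' i (server_msg A i (fun (m : 'I_k') l => g m l))
      else sb j i in
    let g' j i :=
      if j == k' then worker_map A i (grad (f i)) (fun m : 'I_k'.+1 => sb' m i)
      else g j i in
    (g', sb')
  else (fun _ _ => 0, fun _ _ => 0).

(* \bar s_i^k *)
Definition run_sbar (k : nat) (i : 'I_n) : 'rV[R]_d :=
  (protocol_history k.+1).2 k i.

(* g_i^{k+1}: note the shift *)
Definition run_g (k : nat) (i : 'I_n) : 'rV[R]_d :=
  (protocol_history k.+1).1 k i.

(* x^k *)
Definition run_x (k : nat) : 'rV[R]_d :=
  server_point A (fun (j : 'I_k) l => run_g j l).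

(* s_i^k *)
Definition run_s (k : nat) (i : 'I_n) : 'rV[R]_d :=
  server_msg A i (fun (j : 'I_k) l => run_g j l).

Lemma protocol_historyE (k j : nat) : (j < k)%N ->
  (protocol_history k).1 j = run_g j /\ (protocol_history k).2 j = run_sbar j.
Proof.
elim: k => // k IH; rewrite ltnS leq_eqVlt => /predU1P[->//|jk].
have [IH1 IH2] := IH jk; rewrite -IH1 -IH2 /=.
by case: (protocol_history k) => g sb /=; rewrite (ltn_eqF jk).
Qed.

Lemma run_sbarE (k : nat) (i : 'I_n) : run_sbar k i = c k i (run_s k i).
Proof.
rewrite /run_sbar /run_s /=.
have : (fun (j : 'I_k) l => (protocol_history k).1 j l)
       = (fun (j : 'I_k) l => run_g j l).
  by apply/funext => j; have [-> _] := protocol_historyE (ltn_ord j).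
by case: (protocol_history k) => g sb /= <-; rewrite eqxx.
Qed.

Lemma run_gE (k : nat) (i : 'I_n) :
  run_g k i = worker_map A i (grad (f i)) (fun j : 'I_k.+1 => run_sbar j i).
Proof.
have -> : (fun j : 'I_k.+1 => run_sbar j i)
          = (fun j : 'I_k.+1 => (protocol_history k.+1).2 j i).
  by apply/funext => j; have [_ ->] := protocol_historyE (ltn_ord j).
by rewrite /run_g /=; case: (protocol_history k) => g sb /=; rewrite eqxx.
Qed.

End protocol.

(* A_zr: the support conditions bear on the vectors that occur in a run of the
   protocol, for every dimension, all differentiable f_1, ..., f_n and all
   realizations c of the compressor calls. The vectors ghat_m are numbered from
   m = 0. *)
Definition zero_respecting {R : realType} {n : nat}
    (A : forall d, algorithm R n d) : Prop :=
  forall (d : nat) (f : 'I_n -> 'rV[R]_d -> R)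
         (c : nat -> 'I_n -> 'rV[R]_d -> 'rV[R]_d),
    (forall i x, differentiable (f i) x) ->
  let x := run_x (A d) f c in let s := run_s (A d) f c in
  let sbar := run_sbar (A d) f c in let g := run_g (A d) f c in
  forall (k : nat) (i : 'I_n),
  [/\ supp (x k) `<=` \bigcup_(j in [set j | (j < k)%N]) \bigcup_l supp (g j l),
      supp (s k i) `<=` \bigcup_(j in [set j | (j < k)%N]) \bigcup_l supp (g j l) &
      exists ghat : nat -> 'rV[R]_d,
        (forall m, supp (ghat m) `<=`
           (\bigcup_(j in [set j | (j <= k)%N]) supp (sbar j i)) `|`
           (\bigcup_(r in [set r | (r < m)%N]) supp (grad (f i) (ghat r)))) /\
        supp (g k i) `<=` \bigcup_m supp (ghat m)].

(* Main.v *)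
Require Import Defs.
From HB Require Import structures.
From mathcomp Require Import all_boot all_order all_algebra.
From mathcomp Require Import all_classical all_reals all_analysis.
From mathcomp Require Import unstable measurable_realfun.
From mathcomp Require Import ring lra.

Set Implicit Arguments.
Unset Strict Implicit.
Unset Printing Implicit Defensive.

Import Order.TTheory GRing.Theory Num.Theory.
Import numFieldNormedType.Exports.

Local Open Scope classical_set_scope.
Local Open Scope ring_scope.

(** The hard function is a nonconvex chain: its gradient is bounded below as
    long as the last coordinate vanishes, and a point supported on the first m
    coordinates reveals only the coordinate m. The even links go to worker 0
    and the odd ones to worker 1, so a worker cannot extend the support by two
    coordinates without a new message from the server. The compressor keeps its
    input, divided by p, with probability p = 1/(omega + 1), and otherwise sends
    0. Hence the support after k rounds is bounded by the number N of successes
    towards the two active workers, up to 1, and E N = 1 + 2 k p. Averaging the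
    pointwise bound |grad f|^2 >= G (1 - N / T), where T ~ L delta0 / eps is the
    dimension, shows that k ~ T (omega + 1) rounds are not enough.

    The i.i.d. coins are realized on [0, 1[ with the Lebesgue measure: the coin
    of x is [x < p], and rescaling to [0, 1[ the half of x gives a uniform
    variable independent of the coin, to be used for the next one. *)

(** * Affine rescaling of Lebesgue measure *)

Lemma measurable_affine (R : realType) (a b : R) :
  @measurable_fun _ _ (measurableTypeR R) (measurableTypeR R) [set: R]
    (fun x : R => (x - b) / a).
Proof. by apply: measurable_funM => //; apply: measurable_funB. Qed.

(** By uniqueness of Lebesgue measure: the pushforward by the affine map, scaled by [a^-1], gives
    every half-open interval its length. *)
Lemma lebesgue_measure_preimage_affine (R : realType) (a b : R)
    (A : set (measurableTypeR R)) : 0 < a -> measurable A ->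
  lebesgue_measure [set x : R | A ((x - b) / a)] =
    (a%:E * lebesgue_measure A)%E.
Proof.
move=> a0 mA.
have a'0 : 0 <= a^-1 by rewrite invr_ge0 ltW.
pose h : measurableTypeR R -> measurableTypeR R := fun x => (x - b) / a.
pose nu : {measure set (measurableTypeR R) -> \bar R} := 
  measure_function_pushforward__canonical__measure_function_Measure lebesgue_measure (measurable_affine a b).
pose mu : {measure set (measurableTypeR R) -> \bar R} := mscale (NngNum a'0) nu.
have muE B : mu B = ((a^-1)%:E * lebesgue_measure (h @^-1` B))%E by [].
suff H : lebesgue_measure A = mu A.
  by rewrite H muE muleA -EFinM divff ?gt_eqF// mul1e.
apply: lebesgue_measure_unique mA => _ [[x y] _ <-] /=.
rewrite muE.
have -> : h @^-1` `]x, y] = `](a * x + b), (a * y + b)]%classic.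
  apply/seteqP; split=> z /=; rewrite /h !in_itv/= ltr_pdivlMr// ler_pdivrMr//;
  by move=> /andP[? ?]; apply/andP; split; lra.
rewrite !lebesgue_measure_itv/= !lte_fin ltrD2r ltr_pM2l//.
case: ifP => _; last by rewrite mule0.
rewrite -!EFinD -EFinM; congr EFin; field.
by rewrite gt_eqF.
Qed.

(** * I.i.d. seeds read along the orbit of a shift *)

Section iid_shift.
Context {R : realType} {dO dS : measure_display} {Omega : measurableType dO}
  {S : measurableType dS}.
Variables (P : probability Omega R) (nu : probability S R).
Variables (X : Omega -> S) (phi : Omega -> Omega).
Hypotheses (mX : measurable_fun [set: Omega] X)
  (mphi : measurable_fun [set: Omega] phi).
(** With [E] the whole space, [X] has law [nu]; with [B] the whole space, [phi] preserves [P]; the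
    product form then makes [X] and [phi] independent. *)
Hypothesis split_law : forall B E, measurable B -> measurable E ->
  P ((X @^-1` B) `&` (phi @^-1` E)) = (nu B * P E)%E.

Definition shift_seed (t : nat) : Omega -> S := X \o iter t phi.

Lemma measurable_shift_seed t : measurable_fun [set: Omega] (shift_seed t).
Proof.
apply: measurableT_comp => //.
elim: t => [|t IH]; first exact: measurable_id.
exact: (measurableT_comp mphi IH).
Qed.

Lemma measurable_big_setI (I : Type) (r : seq I) (F : I -> set Omega) :
  (forall i, measurable (F i)) -> measurable (\big[setI/setT]_(i <- r) F i).
Proof.
move=> mF; elim/big_ind: _ => //; first exact: measurableI.
Qed.

(** Induction on [M]: the seeds after the first are the seeds from time 0 composed with [phi], so
    [split_law] factors out the first one. *)
Lemma shift_seed_prefix (M : nat) (B : nat -> set S) :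
  (forall t, measurable (B t)) ->
  P (\big[setI/setT]_(0 <= t < M) (shift_seed t @^-1` B t)) =
  (\big[*%E/1%E]_(0 <= t < M) nu (B t))%E.
Proof.
elim: M B => [|M IH] B mB; first by rewrite !big_nil probability_setT.
rewrite !big_nat_recl// -(IH (fun t => B t.+1))//.
rewrite -split_law//; last first.
  apply: measurable_big_setI => t.
  by rewrite -[X in measurable X]setTI; apply: measurable_shift_seed.
congr (P (_ `&` _)); rewrite -[RHS]/(preimage phi _).
rewrite (big_morph (preimage phi) (preimage_setI phi) (preimage_setT phi)).
apply: eq_bigr => t _; apply/seteqP.
by split=> w; rewrite /shift_seed /= -iterSr.
Qed.

(** A finite index set is completed to an initial segment by giving the missing indices the full
    event, of probability one. *)
Lemma shift_seed_indep_nat (J : seq nat) (B : nat -> set S) : uniq J ->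
  (forall t, measurable (B t)) ->
  P (\big[setI/setT]_(t <- J) (shift_seed t @^-1` B t)) =
  (\big[*%E/1%E]_(t <- J) nu (B t))%E.
Proof.
move=> uJ mB.
have [M ltM] : exists M, forall t, t \in J -> (t < M)%N.
  exists (\max_(t <- J) t).+1 => t tJ.
  by rewrite ltnS; exact: (@leq_bigmax_seq _ J xpredT id t tJ).
pose B' t := if t \in J then B t else setT.
have pJ : perm_eq J [seq t <- index_iota 0 M | t \in J].
  apply: uniq_perm => // [|t']; first exact/filter_uniq/iota_uniq.
  rewrite mem_filter mem_index_iota /=; case: (boolP (t' \in J)) => //= /ltM ->//.
have mB' t : measurable (B' t) by rewrite /B'; case: ifP.
have := shift_seed_prefix M mB'.
rewrite (perm_big _ pJ) big_filter [in X in _ -> X = _]big_mkcond.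
rewrite (perm_big (op := *%E) _ pJ) big_filter [in X in _ -> _ = X]big_mkcond /=.
under eq_bigr do rewrite /B' fun_if preimage_setT.
move=> ->; apply: eq_bigr => t _; rewrite /B'.
by case: ifP => // _; rewrite probability_setT.
Qed.

(** Countable indices become times through [pickle]; a time that decodes to no index gets the full
    event. *)
Lemma iid_shift_seeds (I : countType) :
  iid_seeds P nu (fun t : I => shift_seed (pickle t)).
Proof.
have law t B : measurable B -> P (shift_seed t @^-1` B) = nu B.
  move=> mB.
  by have := @shift_seed_indep_nat [:: t] (fun=> B) isT (fun=> mB); rewrite !big_seq1.
split=> [t|t B mB|J B uJ mB]; [exact: measurable_shift_seed|exact: law|].
under [RHS]eq_bigr do rewrite law//.
pose B' m := if unpickle m is Some t then B t else setT.
have mB' m : measurable (B' m) by rewrite /B'; case: unpickle.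
have uJ' : uniq (map pickle J) by rewrite map_inj_uniq//; exact: pcan_inj pickleK.
have := shift_seed_indep_nat uJ' mB'; rewrite !big_map.
under eq_bigr do rewrite /B' pickleK.
by under [in X in _ = X -> _]eq_bigr do rewrite /B' pickleK.
Qed.

End iid_shift.

(** * A coin and its independent remainder on the unit interval *)

Section bernoulli_shift.
Context {R : realType}.

Definition unit_law : set (measurableTypeR R) -> \bar R :=
  mrestr lebesgue_measure (measurable_itv `[0, 1[%R).

HB.instance Definition _ := Measure.on unit_law.

Let unit_law_setT : unit_law [set: R] = 1%E.
Proof. by rewrite /unit_law /mrestr setTI lebesgue_measure_itv/= lte01 oppr0 adde0. Qed.

HB.instance Definition _ :=
  @Measure_isProbability.Build _ _ R unit_law unit_law_setT.

Variable p : R.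
Hypotheses (p0 : 0 < p) (p1 : p <= 1).

Definition coin (x : measurableTypeR R) : bool := x < p.

(* For p = 1 the second branch is junk, but it has probability 0. *)
Definition coin_shift (x : measurableTypeR R) : measurableTypeR R :=
  if x < p then (x - 0) / p else (x - p) / (1 - p).

Lemma measurable_coin : measurable_fun [set: measurableTypeR R] coin.
Proof. exact: measurable_fun_ltr. Qed.

Lemma measurable_coin_shift : measurable_fun [set: measurableTypeR R] coin_shift.
Proof.
apply: measurable_fun_ifT; first exact: measurable_coin.
- exact: measurable_affine.
- exact: measurable_affine.
Qed.

(** Pulling back along a branch of [coin_shift] multiplies the measure by [p] or [1 - p], the
    Bernoulli weight of that branch, so the event is cut according to the coin. *)
Lemma coin_shift_law (B : set bool) (E : set (measurableTypeR R)) :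
  measurable B -> measurable E ->
  unit_law ((coin @^-1` B) `&` (coin_shift @^-1` E)) =
  (bernoulli_prob p B * unit_law E)%E.
Proof.
move=> mB mE; rewrite bernoulli_probE ?(ltW p0)// /onem.
rewrite /unit_law /mrestr.
set E1 := E `&` _; have mE1 : measurable E1 by apply: measurableI.
pose U := [set x : R | true \in B /\ E1 ((x - 0) / p)].
(* The condition [p < 1] keeps [V] empty when [p = 1], where the division by 0 would give 0 for
   every [x]. *)
pose V := [set x : R | [/\ false \in B, p < 1 & E1 ((x - p) / (1 - p))]].
have UE : lebesgue_measure U = (p%:E * \d_true B * lebesgue_measure E1)%E.
  rewrite /dirac indicE /U; case: (boolP (true \in B)) => bB.
    rewrite mule1 -(@lebesgue_measure_preimage_affine _ p 0)//.
    by congr lebesgue_measure; apply/seteqP; split=> x //= [].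
  rewrite mule0 mul0e -[RHS](measure0 lebesgue_measure); congr lebesgue_measure.
  by apply/seteqP; split=> x //= [].
have VE : lebesgue_measure V = ((1 - p)%:E * \d_false B * lebesgue_measure E1)%E.
  rewrite /dirac indicE /V; case: (boolP (false \in B)) => bB; last first.
    rewrite mule0 mul0e -[RHS](measure0 lebesgue_measure); congr lebesgue_measure.
    by apply/seteqP; split=> x //= [].
  have [p_lt1|p_ge1] := ltP p 1.
    rewrite mule1 -(@lebesgue_measure_preimage_affine _ (1 - p) p) ?subr_gt0//.
    by congr lebesgue_measure; apply/seteqP; split=> x //= [].
  have -> : p = 1 by apply/le_anti; rewrite p1.
  rewrite subrr !mul0e -[RHS](measure0 lebesgue_measure); congr lebesgue_measure.
  by apply/seteqP; split=> x //= [].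
have mU : measurable (U : set (measurableTypeR R)).
  rewrite /U; case: (true \in B).
    have := @measurable_affine _ p 0 measurableT E1 mE1; rewrite setTI.
    by congr measurable; apply/seteqP; split=> x //= [].
  by rewrite (_ : [set _ | _] = set0)//; apply/seteqP; split=> x //= [].
have mV : measurable (V : set (measurableTypeR R)).
  rewrite /V; case: (false \in B) => //.
    case: (p < 1).
      have := @measurable_affine _ (1 - p) p measurableT E1 mE1; rewrite setTI.
      by congr measurable; apply/seteqP; split=> x //= [].
    by rewrite (_ : [set _ | _] = set0)//; apply/seteqP; split=> x //= [].
  by rewrite (_ : [set _ | _] = set0)//; apply/seteqP; split=> x //= [].
have Up x : U x -> x < p.
  by case=> _ [_]; rewrite /= in_itv/= subr0 ltr_pdivrMr// mul1r => /andP[].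
have Vp x : V x -> p <= x.
  case=> _ q0 [_]; rewrite /= in_itv/= => /andP[+ _].
  by rewrite ler_pdivlMr ?subr_gt0// mul0r subr_ge0.
rewrite ge0_muleDl; [|by rewrite mule_ge0// lee_fin ltW|].
  rewrite -UE -VE -measureU//; last first.
    by apply/seteqP; split=> x //= [/Up + /Vp]; lra.
  congr lebesgue_measure; apply/seteqP; split=> x.
    rewrite /coin /coin_shift /=; case: ltP => xp [[xB xE]]; rewrite in_itv/= => /andP[x0 x1].
      left; split; first by rewrite inE.
      split=> //=; rewrite in_itv/= subr0 divr_ge0// ?ltr_pdivrMr//; last exact: ltW.
      by rewrite mul1r.
    have q0 : 0 < 1 - p by lra.
    right; split; [by rewrite inE|lra|].
    split=> //=; rewrite in_itv/= divr_ge0// ?ltr_pdivrMr//; lra.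
  rewrite /coin /coin_shift /= => -[xU|xV].
    rewrite (Up _ xU); case: xU => xB [xE]; rewrite /= in_itv/= subr0 => /andP[x0].
    rewrite ltr_pdivrMr// mul1r => x1; rewrite inE in xB; rewrite subr0 in xE *.
    split=> //; rewrite in_itv/=; apply/andP; split; last exact: lt_le_trans x1 p1.
    by move: x0; rewrite ler_pdivlMr// mul0r.
  rewrite (ltNge x) (Vp _ xV) /=; case: xV => xB q0 [xE]; rewrite /= in_itv/= => /andP[x0].
  move: x0; rewrite ltr_pdivrMr ?ler_pdivlMr ?subr_gt0// mul0r mul1r.
  rewrite subr_ge0 ltrBlDr subrK => x0 x1; rewrite inE in xB.
  by split=> //; rewrite in_itv/= (le_trans (ltW p0) x0).
by rewrite mule_ge0// lee_fin onem_ge0.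
Qed.

End bernoulli_shift.

(** * One-variable profiles and the two-variable link *)

Section step_function.
Context {R : realType}.
Implicit Types x y : R.

Definition ppart x : R := Num.max x 0.

Variant ppart_spec x : R -> Prop :=
| PpartPos of 0 <= x : ppart_spec x x
| PpartNeg of x <= 0 : ppart_spec x 0.

Lemma ppartP x : ppart_spec x (ppart x).
Proof. by rewrite /ppart; case: leP => [|/ltW] ?; constructor. Qed.

Lemma ppart_lip x y : `|ppart x - ppart y| <= `|x - y|.
Proof.
have H (a : R) : a <= `|a| by exact: ler_norm.
have H' (a : R) : - a <= `|a| by rewrite ler_normr lexx orbT.
have := H (x - y); have := H' (x - y); rewrite ler_norml.
by case: ppartP => ?; case: ppartP => ? ? ?; apply/andP; split; lra.
Qed.

(** The square of the positive part is C^1 with the 2-Lipschitz derivative [2 * ppart]; [step]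
    inherits its remainder bound term by term. *)
Lemma ppart_sqr_rem x y :
  `|ppart y ^+ 2 - ppart x ^+ 2 - 2 * ppart x * (y - x)| <= (y - x) ^+ 2.
Proof.
rewrite ler_norml; have := sqr_ge0 (y - x); have := sqr_ge0 x; have := sqr_ge0 y.
case: (ppartP x) => x0; case: (ppartP y) => y0; rewrite ?expr2.
- by move=> *; apply/andP; split; nra.
- have := mulr_ge0_le0 x0 y0.
  by move=> *; apply/andP; split; nra.
- have := mulr_le0_ge0 x0 y0.
  by move=> *; apply/andP; split; nra.
- by move=> *; apply/andP; split; nra.
Qed.

(* The C^1 piecewise quadratic transition from 0 on x <= 0 to 1 on 1 <= x. *)
Definition step x : R :=
  2 * ppart x ^+ 2 - 4 * ppart (x - 2^-1) ^+ 2 + 2 * ppart (x - 1) ^+ 2.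

Definition dstep x : R :=
  4 * ppart x - 8 * ppart (x - 2^-1) + 4 * ppart (x - 1).

Lemma step_ge0 x : 0 <= step x.
Proof. by rewrite /step; case: ppartP => ?; case: ppartP => ?; case: ppartP => ?; nra. Qed.

Lemma step_le1 x : step x <= 1.
Proof. by rewrite /step; case: ppartP => ?; case: ppartP => ?; case: ppartP => ?; nra. Qed.

Lemma dstep_ge0 x : 0 <= dstep x.
Proof. by rewrite /dstep; case: ppartP => ?; case: ppartP => ?; case: ppartP => ?; lra. Qed.

Lemma dstep_le2 x : dstep x <= 2.
Proof. by rewrite /dstep; case: ppartP => ?; case: ppartP => ?; case: ppartP => ?; lra. Qed.

Lemma step_eq0 x : x <= 0 -> step x = 0.
Proof.
by move=> x0; rewrite /step; case: ppartP => ?; case: ppartP => ?; case: ppartP => ?; nra.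
Qed.

Lemma dstep_eq0 x : x <= 0 -> dstep x = 0.
Proof.
by move=> x0; rewrite /dstep; case: ppartP => ?; case: ppartP => ?; case: ppartP => ?; lra.
Qed.

Lemma step_eq1 x : 1 <= x -> step x = 1.
Proof.
by move=> x0; rewrite /step; case: ppartP => ?; case: ppartP => ?; case: ppartP => ?; nra.
Qed.

Lemma dstep_ge1 x : 4^-1 <= x <= 3 / 4 -> 1 <= dstep x.
Proof.
by case/andP => *; rewrite /dstep; case: ppartP => ?; case: ppartP => ?; case: ppartP => ?; lra.
Qed.

Lemma dstep_lip x y : `|dstep x - dstep y| <= 16 * `|x - y|.
Proof.
have := ppart_lip x y; have := ppart_lip (x - 2^-1) (y - 2^-1).
have := ppart_lip (x - 1) (y - 1).
have -> : x - 1 - (y - 1) = x - y by ring.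
have -> : x - 2^-1 - (y - 2^-1) = x - y by ring.
rewrite /dstep !ler_norml => /andP[? ?] /andP[? ?] /andP[? ?].
by apply/andP; split; lra.
Qed.

Lemma step_rem x y : `|step y - step x - dstep x * (y - x)| <= 8 * (y - x) ^+ 2.
Proof.
have := ppart_sqr_rem x y; have := ppart_sqr_rem (x - 2^-1) (y - 2^-1).
have := ppart_sqr_rem (x - 1) (y - 1).
have -> : y - 1 - (x - 1) = y - x by ring.
have -> : y - 2^-1 - (x - 2^-1) = y - x by ring.
rewrite /dstep /step !ler_norml => /andP[? ?] /andP[? ?] /andP[? ?].
by apply/andP; split; lra.
Qed.

(* Deduced from the remainder for close points and from the bounds otherwise. *)
Lemma step_lip x y : `|step y - step x| <= 10 * `|y - x|.
Proof.
have [xy|xy] := leP 1 (10 * `|y - x|).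
  apply: le_trans xy; rewrite ler_norml.
  have := step_ge0 x; have := step_ge0 y; have := step_le1 x; have := step_le1 y.
  by move=> *; apply/andP; split; lra.
have H := step_rem x y.
have -> : step y - step x = (step y - step x - dstep x * (y - x)) + dstep x * (y - x) by ring.
apply: le_trans (ler_normD _ _) _; rewrite normrM.
have : `|dstep x| * `|y - x| <= 2 * `|y - x|.
  by rewrite ler_wpM2r// ger0_norm ?dstep_ge0// dstep_le2.
have D0 : 0 <= `|y - x| by [].
have : `|y - x| ^+ 2 = (y - x) ^+ 2 by rewrite real_normK ?num_real.
by move=> E ?; rewrite -E in H; nra.
Qed.

(* Rescaled so that the slope is at least 1/4 on the whole of [-1, 1]. *)
Definition ramp x : R := step ((x + 2) / 4).
Definition dramp x : R := dstep ((x + 2) / 4) / 4.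

Lemma ramp_ge0 x : 0 <= ramp x. Proof. exact: step_ge0. Qed.
Lemma ramp_le1 x : ramp x <= 1. Proof. exact: step_le1. Qed.
Lemma dramp_ge0 x : 0 <= dramp x.
Proof. by have := dstep_ge0 ((x + 2) / 4); rewrite /dramp; lra. Qed.
Lemma dramp_le x : dramp x <= 2^-1.
Proof. by have := dstep_le2 ((x + 2) / 4); rewrite /dramp; lra. Qed.

Lemma dramp_ge x : -1 <= x <= 1 -> 4^-1 <= dramp x.
Proof.
case/andP => *; have : 1 <= dstep ((x + 2) / 4).
  by apply: dstep_ge1; apply/andP; split; lra.
by rewrite /dramp; lra.
Qed.

Let ramp_argB x y : (y + 2) / 4 - (x + 2) / 4 = (y - x) / 4.
Proof. by ring. Qed.

Lemma ramp_lip x y : `|ramp y - ramp x| <= 3 * `|y - x|.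
Proof.
have := step_lip ((x + 2) / 4) ((y + 2) / 4).
rewrite ramp_argB normrM (@ger0_norm _ 4^-1)// -/(ramp _) -/(ramp _).
by have := normr_ge0 (y - x); lra.
Qed.

Lemma dramp_lip x y : `|dramp y - dramp x| <= `|y - x|.
Proof.
have := dstep_lip ((y + 2) / 4) ((x + 2) / 4).
rewrite ramp_argB normrM (@ger0_norm _ 4^-1)// /dramp -mulrBl normrM.
by rewrite (@ger0_norm _ 4^-1)//; lra.
Qed.

Lemma ramp_rem x y : `|ramp y - ramp x - dramp x * (y - x)| <= (y - x) ^+ 2.
Proof.
have := step_rem ((x + 2) / 4) ((y + 2) / 4).
rewrite ramp_argB -/(ramp _) -/(ramp _).
have -> : dstep ((x + 2) / 4) * ((y - x) / 4) = dramp x * (y - x).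
  by rewrite /dramp; ring.
by have := sqr_ge0 (y - x); rewrite exprMn; lra.
Qed.

(* The penalty takes over where [b < -1] and the slope of [ramp] may vanish. *)
Definition link a b : R := ppart (- b) ^+ 2 - step a * ramp b.
Definition link_l a b : R := - (dstep a * ramp b).
Definition link_r a b : R := - 2 * ppart (- b) - step a * dramp b.

(** The remainder of the product splits into those of its factors and a mixed term, absorbed by 2uv
    <= u^2 + v^2. The constant only serves differentiability and is not sharp. *)
Lemma link_rem a b a' b' :
  `|link a' b' - link a b - link_l a b * (a' - a) - link_r a b * (b' - b)|
   <= 20 * ((a' - a) ^+ 2 + (b' - b) ^+ 2).
Proof.
have Hp := ppart_sqr_rem (- b) (- b').
have Hs := step_rem a a'; have Hr := ramp_rem b b'; have Hl := ramp_lip b b'.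
rewrite (_ : - b' - - b = - (b' - b)) in Hp; last by ring.
rewrite sqrrN in Hp.
set u := ppart (- b') ^+ 2 - _ - _ in Hp.
set v := step a' - _ - _ in Hs.
set w := ramp b' - _ - _ in Hr.
rewrite [X in `|X|](_ : _ = u - (step a * w + v * ramp b' +
   dstep a * ((a' - a) * (ramp b' - ramp b)))); last first.
  by rewrite /u /v /w /link /link_l /link_r; ring.
have s0 := step_ge0 a; have s1 := step_le1 a.
have r0 := ramp_ge0 b'; have r1 := ramp_le1 b'.
have d0 := dstep_ge0 a; have d2 := dstep_le2 a.
have e1 : `|step a * w| <= (b' - b) ^+ 2.
  by rewrite normrM (ger0_norm s0) (le_trans _ Hr)// ler_piMl.
have e2 : `|v * ramp b'| <= 8 * (a' - a) ^+ 2.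
  by rewrite normrM (ger0_norm r0) (le_trans _ Hs)// ler_piMr.
have e3 : `|(a' - a) * (ramp b' - ramp b)| <= 3 * (`|a' - a| * `|b' - b|).
  by rewrite normrM mulrCA ler_wpM2l.
have e4 : `|dstep a * ((a' - a) * (ramp b' - ramp b))| <= 2 * (3 * (`|a' - a| * `|b' - b|)).
  by rewrite normrM (ger0_norm d0) ler_pM.
have e5 : 2 * (`|a' - a| * `|b' - b|) <= (a' - a) ^+ 2 + (b' - b) ^+ 2.
  rewrite -(real_normK (num_real (a' - a))) -(real_normK (num_real (b' - b))).
  by have := sqr_ge0 (`|a' - a| - `|b' - b|); rewrite sqrrB; lra.
have := ler_normB u (step a * w + v * ramp b' + dstep a * ((a' - a) * (ramp b' - ramp b))).
have := ler_normD (step a * w + v * ramp b') (dstep a * ((a' - a) * (ramp b' - ramp b))).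
have := ler_normD (step a * w) (v * ramp b').
have := sqr_ge0 (a' - a); have := sqr_ge0 (b' - b).
by lra.
Qed.

(** These constants and those of [link_r_lip] determine the smoothness constant of the chain. *)
Lemma link_l_lip a b a' b' :
  `|link_l a' b' - link_l a b| <= 16 * `|a' - a| + 6 * `|b' - b|.
Proof.
rewrite /link_l opprK addrC.
rewrite (_ : _ + _ = - (dstep a' - dstep a) * ramp b' - dstep a * (ramp b' - ramp b)); last by ring.
apply: le_trans (ler_normB _ _) _; rewrite !normrM normrN.
rewrite (ger0_norm (ramp_ge0 _)) (ger0_norm (dstep_ge0 _)).
apply: lerD.
  by apply: le_trans (dstep_lip a' a); rewrite ler_piMr// ramp_le1.
have -> : 6 * `|b' - b| = 2 * (3 * `|b' - b|) by ring.
by rewrite ler_pM ?dstep_ge0 ?dstep_le2 ?ramp_lip.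
Qed.

Lemma link_r_lip a b a' b' :
  `|link_r a' b' - link_r a b| <= 5 * `|a' - a| + 3 * `|b' - b|.
Proof.
rewrite /link_r.
rewrite [X in `|X|](_ : _ = - (2 * (ppart (- b') - ppart (- b))) -
  ((step a' - step a) * dramp b' + step a * (dramp b' - dramp b))); last by ring.
apply: le_trans (ler_normB _ _) _.
have e1 : `|- (2 * (ppart (- b') - ppart (- b)))| <= 2 * `|b' - b|.
  rewrite normrN normrM ger0_norm// ler_wpM2l//.
  by apply: le_trans (ppart_lip _ _) _; rewrite -opprD normrN.
have e2 : `|(step a' - step a) * dramp b'| <= 5 * `|a' - a|.
  rewrite normrM (ger0_norm (dramp_ge0 _)).
  have -> : 5 * `|a' - a| = (10 * `|a' - a|) * 2^-1 by field.
  by rewrite ler_pM// ?dramp_ge0// ?step_lip// dramp_le.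
have e3 : `|step a * (dramp b' - dramp b)| <= `|b' - b|.
  rewrite normrM (ger0_norm (step_ge0 _)).
  by apply: le_trans (dramp_lip b b'); rewrite ler_piMl// step_le1.
have := ler_normD ((step a' - step a) * dramp b') (step a * (dramp b' - dramp b)).
by lra.
Qed.

End step_function.

(** * Differentiability and gradient read off a quadratic remainder *)

Section quadratic_remainder.
Context {R : realType} {d : nat}.
Variables (f : 'rV[R]_d -> R) (x G : 'rV[R]_d) (K : R).
Hypothesis rem : forall y,
  `|f y - f x - \sum_(j < d) G 0 j * (y 0 j - x 0 j)| <= K * `|y - x| ^+ 2.

Let lin (v : 'rV[R]_d) : R := \sum_(j < d) G 0 j * v 0 j.

Let lin_is_linear : linear lin.
Proof.
move=> a u v; rewrite /lin scaler_sumr -big_split; apply: eq_bigr => j _ /=.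
by rewrite !mxE mulrDr /GRing.scale/= mulrCA.
Qed.

HB.instance Definition _ := GRing.isLinear.Build R 'rV[R]_d R _ lin lin_is_linear.

Let lin_continuous : continuous lin.
Proof.
move=> v; apply: differentiable_continuous.
have -> : lin = \sum_(j < d) (fun v : 'rV[R]_d => G 0 j * v 0 j).
  by apply/funext => u; rewrite fct_sumE.
by apply: differentiable_sum => j; apply: differentiableM; [exact: differentiable_cst|exact: differentiable_coord].
Qed.

Let lin_rem e : 0 < e ->
  \forall h \near (0 : 'rV[R]_d), `|f (h + x) - (f x + lin h)| <= e * `|h|.
Proof.
move=> e0; near=> h.
rewrite [X in `|X|](_ : _ = f (h + x) - f x - \sum_(j < d) G 0 j * ((h + x) 0 j - x 0 j)); last first.
  rewrite opprD addrA; congr (_ - _); apply: eq_bigr => j _.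
  by rewrite mxE addrK.
apply: le_trans (rem _) _; rewrite addrK expr2 mulrA ler_wpM2r//.
(* The shift by 1 keeps the divisor positive even if [K] is 0; below the radius [e / (|K| + 1)], the
   factor [K * |h|] is at most [e]. *)
have K1 : 0 < `|K| + 1 by rewrite ltr_wpDl.
have : `|h| <= e / (`|K| + 1) by near: h; apply: (@nbhs0_le R 'rV[R]_d); rewrite divr_gt0.
rewrite ler_pdivlMr// mulrC; apply: le_trans.
by rewrite ler_wpM2r// (le_trans (ler_norm K))// lerDl.
Unshelve. all: by end_near. Qed.

Let diffE : 'd f x = lin :> ('rV[R]_d -> R).
Proof. by apply: diff_unique => //; apply/eqaddoP => e e0; exact: lin_rem. Qed.

Lemma quadratic_rem_differentiable : differentiable f x.
Proof.
by apply/diff_locallyP; rewrite diffE; split=> //; apply/eqaddoP => e e0; exact: lin_rem.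
Qed.

Lemma quadratic_rem_grad : grad f x = G.
Proof.
apply/rowP => j; rewrite mxE deriveE; last exact: quadratic_rem_differentiable.
rewrite diffE /lin (bigD1 j)//= mxE !eqxx mulr1 big1 ?addr0// => i ij.
by rewrite mxE eqxx (negbTE ij) mulr0.
Qed.

End quadratic_remainder.

(** * The Bernoulli compressor *)

Lemma integral_bernoulli_prob_EFin (R : realType) (p : R) (f : bool -> R) :
  0 <= p <= 1 ->
  (\int[bernoulli_prob p]_b (f b)%:E = (p * f true + (1 - p) * f false)%:E)%E.
Proof.
move=> p01; rewrite integralE !integral_bernoulli_prob//.
rewrite !funeposE !funenegE -!EFinN -!EFin_max /onem -!EFinM -?EFinD.
congr EFin; have maxB (a : R) : Num.max a 0 - Num.max (- a) 0 = a.
  by case: (leP a 0) => a0; case: (leP (- a) 0) => a0'; lra.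
by rewrite -[in RHS](maxB (f true)) -[in RHS](maxB (f false)); ring.
Qed.

Lemma enorm_sqr (R : realType) d (x : 'rV[R]_d) :
  enorm x ^+ 2 = \sum_(j < d) x 0 j ^+ 2.
Proof. by rewrite sqr_sqrtr// sumr_ge0// => j _; rewrite sqr_ge0. Qed.

Definition drop_compressor {R : realType} {d : nat} (p : R) (b : bool)
  (x : 'rV[R]_d) : 'rV[R]_d := if b then p^-1 *: x else 0.

(** The variance factor is [p * omega ^+ 2 + (1 - p)], which equals [omega] because
    [p * (omega + 1) = 1]. *)
Lemma drop_compressor_unbiased (R : realType) (d : nat) (omega : R) :
  0 <= omega ->
  unbiased_compressor (bernoulli_prob (omega + 1)^-1) omega
    (@drop_compressor R d (omega + 1)^-1).
Proof.
move=> omega0; set p := (omega + 1)^-1.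
have p0 : 0 < p by rewrite invr_gt0; lra.
have p1 : p <= 1 by rewrite invf_le1; lra.
have p01 : 0 <= p <= 1 by rewrite p1 ltW.
have pV : p^-1 = omega + 1 by rewrite invrK.
have pE : p * (omega + 1) = 1 by rewrite -pV divff ?gt_eqF.
split=> [j|x j|x].
- rewrite (_ : (fun _ => _) = (fun q => if q.1 then p^-1 * tnth q.2 j else 0)); last first.
    by apply/funext => -[[] t] /=; rewrite !mxE.
  apply: measurable_fun_ifT => //.
  apply: measurable_funM => //.
  exact: (measurableT_comp (measurable_tnth j)).
- rewrite unlock integral_bernoulli_prob_EFin// /drop_compressor !mxE mulr0 addr0.
  by rewrite mulVKf// gt_eqF.
- rewrite unlock (integral_bernoulli_prob_EFin (fun u => _ ^+ 2))// lee_fin /drop_compressor.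
  have -> : p^-1 *: x - x = omega *: x by rewrite pV scalerDl scale1r addrK.
  rewrite sub0r !enorm_sqr; set s := \sum_(j < d) x 0 j ^+ 2.
  have -> : \sum_(j < d) (omega *: x) 0 j ^+ 2 = omega ^+ 2 * s.
    by rewrite mulr_sumr; apply: eq_bigr => j _; rewrite mxE exprMn.
  have -> : \sum_(j < d) (- x) 0 j ^+ 2 = s.
    by apply: eq_bigr => j _; rewrite mxE sqrrN.
  rewrite [leLHS](_ : _ = omega * (p * (omega + 1)) * s + (1 - p * (omega + 1)) * s); last by ring.
  by rewrite pE subrr mul0r addr0 mulr1.
Qed.

(** * The chain: gradient, smoothness, values and supports *)

Section chain_function.
Context {R : realType} {T : nat}.
Variable lam : R.
Hypothesis lam0 : 0 < lam.
Implicit Types (x y : 'rV[R]_T) (wt : nat -> R).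

(* The coordinates of x / lam, preceded by the constant 1 and followed by 0. *)
Definition node x (j : nat) : R :=
  if j is c.+1 then (if insub c is Some i then x 0 i / lam else 0) else 1.

Arguments node : simpl never.

Definition chain wt x : R :=
  \sum_(j < T.+1) wt j * link (node x j) (node x j.+1).

(** Coordinate [c] is, up to scaling, node [c.+1]: the right end of link [c] and the left end of
    link [c.+1], whence two terms. *)
Definition chain_grad wt x : 'rV[R]_T := \row_(c < T)
  (lam^-1 * (wt c * link_r (node x c) (node x c.+1) +
             wt c.+1 * link_l (node x c.+1) (node x c.+2))).

Lemma nodeS x (c : 'I_T) : node x c.+1 = x 0 c / lam.
Proof. by rewrite /node valK. Qed.

Lemma node_out x c : (T <= c)%N -> node x c.+1 = 0.
Proof. by move=> Tc; rewrite /node insubN// -leqNgt. Qed.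

Lemma node_norm x y j : `|node y j - node x j| <= `|y - x| / lam.
Proof.
have ge0 : 0 <= `|y - x| / lam by rewrite divr_ge0// ltW.
case: j => [|c]; first by rewrite subrr normr0.
have [cT|Tc] := ltnP c T; last by rewrite !node_out// subrr normr0.
rewrite (nodeS x (Ordinal cT)) (nodeS y (Ordinal cT)) -mulrBl normrM.
rewrite (@gtr0_norm _ lam^-1) ?invr_gt0// ler_wpM2r ?invr_ge0 ?(ltW lam0)//.
set i := Ordinal cT.
have -> : y 0 i - x 0 i = (y - x) 0 i by rewrite !mxE.
rewrite [leRHS]/Num.norm/= mx_normrE.
exact: (le_bigmax _ (fun ij => `|(y - x) ij.1 ij.2|) (0, i)).
Qed.

Let D x y j := node y j - node x j.

Let D0 x y : D x y 0 = 0. Proof. by rewrite /D subrr. Qed.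

Let DT x y : D x y T.+1 = 0. Proof. by rewrite /D !node_out// subrr. Qed.

Lemma chain_rem wt x y :
  `|chain wt y - chain wt x - \sum_(c < T) chain_grad wt x 0 c * (y 0 c - x 0 c)|
  <= (\sum_(j < T.+1) `|wt j| * (40 / lam ^+ 2)) * `|y - x| ^+ 2.
Proof.
have lamN0 : lam != 0 by rewrite gt_eqF.
pose l j := link_l (node x j) (node x j.+1).
pose r j := link_r (node x j) (node x j.+1).
(* The sum over coordinates is regrouped by links; the two additional end terms vanish because nodes
   [0] and [T.+1] are constant. *)
have -> : \sum_(c < T) chain_grad wt x 0 c * (y 0 c - x 0 c) =
    \sum_(j < T.+1) wt j * (l j * D x y j + r j * D x y j.+1).
  under [RHS]eq_bigr do rewrite mulrDr.
  rewrite big_split /= [X in X + _]big_ord_recl /= D0 !mulr0 add0r.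
  rewrite [X in _ + X]big_ord_recr /= DT !mulr0 addr0 -big_split.
  apply: eq_bigr => c _; rewrite mxE /D !nodeS /l /r /bump /= add1n.
  by rewrite !nodeS; field.
rewrite -!sumrB mulr_suml; apply: le_trans (ler_norm_sum _ _ _) _.
apply: ler_sum => j _; rewrite -!mulrBr normrM -!mulrA ler_wpM2l//.
have := link_rem (node x j) (node x j.+1) (node y j) (node y j.+1).
rewrite -/(l j) -/(r j) -/(D x y j) -/(D x y j.+1) => H.
have subD (u v p q : R) : u - v - (p + q) = u - v - p - q by ring.
rewrite subD; apply: le_trans H _.
have sq k : D x y k ^+ 2 <= (`|y - x| / lam) ^+ 2.
  rewrite -(real_normK (num_real (D x y k))) ler_sqr ?nnegrE//.
    exact: node_norm.
  by rewrite divr_ge0// ltW.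
have := sq j; have := sq j.+1; rewrite expr_div_n.
rewrite [lam ^- 2 * _]mulrC.
by lra.
Qed.

Lemma chain_differentiable wt x : differentiable (chain wt) x.
Proof. exact: quadratic_rem_differentiable (chain_rem wt x). Qed.

Lemma grad_chain wt x : grad (chain wt) x = chain_grad wt x.
Proof. exact: quadratic_rem_grad (chain_rem wt x). Qed.

(** A partial derivative involves three consecutive nodes, with coefficients at most 19 = 3 + 16,
    and each node occurs in at most three of them. The two factors 3 in the squares give 57 = 19 *
    3, whatever the dimension. *)
Lemma chain_grad_lip (a : R) x y : 0 <= a ->
  enorm (chain_grad (fun=> a) y - chain_grad (fun=> a) x) <=
  57 * a / lam ^+ 2 * enorm (y - x).
Proof.
move=> a0.
have lamN0 : lam != 0 by rewrite gt_eqF.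
have e0 (z : 'rV[R]_T) : 0 <= enorm z by rewrite sqrtr_ge0.
have k0 : 0 <= 57 * a / lam ^+ 2 by apply: divr_ge0; [exact: mulr_ge0|exact: sqr_ge0].
suff : enorm (chain_grad (fun=> a) y - chain_grad (fun=> a) x) ^+ 2 <=
    (57 * a / lam ^+ 2 * enorm (y - x)) ^+ 2.
  rewrite ler_sqr// nnegrE; [exact: e0|exact: mulr_ge0].
rewrite exprMn !enorm_sqr.
pose d j := D x y j ^+ 2.
have d0 j : 0 <= d j by rewrite sqr_ge0.
set s := \sum_(c < T) _.
have sE : \sum_(c < T) d c.+1 = (lam ^+ 2)^-1 * \sum_(c < T) (y - x) 0 c ^+ 2.
  rewrite mulr_sumr; apply: eq_bigr => c _.
  by rewrite /d /D !nodeS !mxE -mulrBl exprMn exprVn mulrC.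
have s1 : \sum_(c < T) d c <= \sum_(c < T) d c.+1.
  have : \sum_(c < T) d c <= \sum_(c < T.+1) d c by rewrite big_ord_recr /= lerDl.
  by rewrite big_ord_recl /= {2}/d D0 expr0n add0r.
have s2 : \sum_(c < T) d c.+2 <= \sum_(c < T) d c.+1.
  have : \sum_(c < T) d c.+2 <= \sum_(c < T.+1) d c.+1 by rewrite big_ord_recl /= lerDr.
  by rewrite [leRHS]big_ord_recr /= {3}/d DT expr0n addr0.
have -> : (57 * a / lam ^+ 2) ^+ 2 * \sum_(c < T) (y - x) 0 c ^+ 2 =
    (19 * a / lam) ^+ 2 * 3 * (3 * \sum_(c < T) d c.+1).
  by rewrite sE; field.
apply: (@le_trans _ _ ((19 * a / lam) ^+ 2 * 3 *
    (\sum_(c < T) d c + \sum_(c < T) d c.+1 + \sum_(c < T) d c.+2))); last first.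
  apply: ler_wpM2l; first by rewrite mulr_ge0// sqr_ge0.
  by lra.
rewrite -!big_split mulr_sumr; apply: ler_sum => c _ /=.
rewrite !mxE -mulrBr.
set A := link_r _ _; set A' := link_l _ _; set B := link_r _ _; set B' := link_l _ _.
have -> : a * A + a * A' - (a * B + a * B') = a * ((A - B) + (A' - B')) by ring.
have H1 : `|A - B| <= 5 * `|D x y c| + 3 * `|D x y c.+1| := link_r_lip _ _ _ _.
have H2 : `|A' - B'| <= 16 * `|D x y c.+1| + 6 * `|D x y c.+2| := link_l_lip _ _ _ _.
have H3 : `|A - B + (A' - B')| <= 19 * (`|D x y c| + `|D x y c.+1| + `|D x y c.+2|).
  have := normr_ge0 (D x y c); have := normr_ge0 (D x y c.+1).
  have := normr_ge0 (D x y c.+2); have := ler_normD (A - B) (A' - B').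
  by lra.
have H4 : (A - B + (A' - B')) ^+ 2 <= 19 ^+ 2 * (3 * (d c + d c.+1 + d c.+2)).
  rewrite -(real_normK (num_real _)).
  apply: (@le_trans _ _ ((19 * (`|D x y c| + `|D x y c.+1| + `|D x y c.+2|)) ^+ 2)).
    by rewrite ler_sqr ?nnegrE// mulr_ge0// !addr_ge0.
  rewrite exprMn ler_wpM2l// ?exprn_ge0// /d.
  rewrite -(real_normK (num_real (D x y c))) -(real_normK (num_real (D x y c.+1))).
  rewrite -(real_normK (num_real (D x y c.+2))).
  move: `|D x y c| `|D x y c.+1| `|D x y c.+2| => u v w.
  by have := sqr_ge0 (u - v); have := sqr_ge0 (v - w); have := sqr_ge0 (u - w); nra.
have -> : (lam^-1 * (a * (A - B + (A' - B')))) ^+ 2 =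
   (a / lam) ^+ 2 * (A - B + (A' - B')) ^+ 2 by field.
have -> : (19 * a / lam) ^+ 2 * 3 * (d c + d c.+1 + d c.+2) =
   (a / lam) ^+ 2 * (19 ^+ 2 * (3 * (d c + d c.+1 + d c.+2))) by field.
by rewrite ler_wpM2l// sqr_ge0.
Qed.

(** Each link is at least -1: it subtracts from a square a product of two values in [0, 1]. *)
Lemma chain_ge (a : R) x : 0 <= a -> - (a * T.+1%:R) <= chain (fun=> a) x.
Proof.
move=> a0; rewrite /chain -mulr_sumr -mulrN ler_wpM2l//.
rewrite -[leLHS]mulN1r mulr_natr -[X in _ *+ X]card_ord -sumr_const.
apply: ler_sum => j _; rewrite /link.
have := step_ge0 (node x j); have := step_le1 (node x j).
have := ramp_ge0 (node x j.+1); have := ramp_le1 (node x j.+1).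
have := sqr_ge0 (ppart (- node x j.+1)).
by move=> *; nra.
Qed.

Lemma chain0_le0 (a : R) : 0 <= a -> chain (fun=> a) 0 <= 0.
Proof.
move=> a0; apply: sumr_le0 => j _; rewrite mulr_ge0_le0// /link.
have -> : node 0 j.+1 = 0 by rewrite /node; case: insub => // i; rewrite mxE mul0r.
rewrite oppr0 /ppart maxxx expr0n sub0r oppr_le0.
by rewrite mulr_ge0 ?step_ge0 ?ramp_ge0.
Qed.

Lemma node_supp x m j : supp x `<=` [set i | (i < m)%N] -> (m < j)%N -> node x j = 0.
Proof.
case: j => // j sx mj; have [jT|Tj] := ltnP j T; last exact: node_out.
rewrite (nodeS x (Ordinal jT)); have [->|xj] := eqVneq (x 0 (Ordinal jT)) 0.
  by rewrite mul0r.
by have /= := sx (Ordinal jT) xj; rewrite ltnNge -ltnS mj.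
Qed.

(** A link with both ends 0 has zero partial derivatives, as [step] and [dstep] vanish at 0. So the
    only coordinate that can appear is [m], through link [m]. *)
Lemma chain_grad_supp wt x m : supp x `<=` [set i | (i < m)%N] ->
  supp (chain_grad wt x) `<=` [set i | (i < m + (wt m != 0%R))%N].
Proof.
move=> sx c; rewrite /supp/= mxE; apply: contraNT; rewrite -leqNgt => mc.
have mc' : (m <= c)%N by rewrite (leq_trans _ mc)// leq_addr.
rewrite /link_l /link_r (node_supp sx (j := c.+1))//.
rewrite (dstep_eq0 (lexx 0)) mul0r oppr0 mulr0 addr0 /ppart maxxx mulr0 sub0r.
move: mc'; rewrite leq_eqVlt => /predU1P[cm|mc']; last first.
  by rewrite (node_supp sx mc') (step_eq0 (lexx 0)) mul0r oppr0 !mulr0.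
move: mc; rewrite -cm -[leqRHS]addn0 leq_add2l leqn0 eqb0 negbK => /eqP ->.
by rewrite mul0r mulr0.
Qed.

Lemma chain_grad_ge (a : R) x m : 0 <= a -> supp x `<=` [set i | (i < m)%N] ->
  (m < T)%N -> (a / lam / 4) ^+ 2 <= enorm (chain_grad (fun=> a) x) ^+ 2.
Proof.
move=> a0 sx mT.
(* The nodes start at 1 and end at 0: at the first node below 1, both
   contributions to the partial derivative are nonpositive. *)
have ex : exists j, node x j < 1 by exists m.+1; rewrite (node_supp sx).
case: (ex_minnP ex) => -[|c]; first by rewrite /node ltxx.
move=> xc cmin.
(* Minimality against node [m.+1], which is 0, gives [c <= m], so node [c.+1] is a genuine
   coordinate. *)
have cT : (c < T)%N.
  by rewrite (leq_ltn_trans _ mT)// -ltnS cmin// (node_supp sx).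
have xc' : 1 <= node x c by rewrite leNgt; apply/negP => /cmin; rewrite ltnn.
have slope : link_r (node x c) (node x c.+1) + link_l (node x c.+1) (node x c.+2) <= - 4^-1.
  rewrite /link_r /link_l (step_eq1 xc') mul1r.
  have := mulr_ge0 (dstep_ge0 (node x c.+1)) (ramp_ge0 (node x c.+2)).
  have := dramp_ge0 (node x c.+1).
  have [b1|b1] := leP (-1) (node x c.+1).
    have : 4^-1 <= dramp (node x c.+1) by rewrite dramp_ge// b1 ltW.
    by case: ppartP => ? *; lra.
  by case: ppartP => ? *; lra.
rewrite enorm_sqr (bigD1 (Ordinal cT))//= mxE -[leLHS]addr0 lerD//; last first.
  by apply: sumr_ge0 => i _; rewrite sqr_ge0.
rewrite -mulrDr mulrA (mulrC lam^-1) -[leLHS]sqrrN -mulrN.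
rewrite -[leRHS]sqrrN -mulrN -[leLHS]sqrrN -mulrN opprK ler_sqr ?nnegrE; last first.
- by rewrite mulr_ge0 ?divr_ge0 ?(ltW lam0)//; lra.
- by rewrite mulr_ge0 ?divr_ge0 ?(ltW lam0)//.
by rewrite ler_wpM2l ?divr_ge0 ?(ltW lam0)//; lra.
Qed.

End chain_function.

(** * Distribution of the links over the workers *)

Section worker_split.
Context {R : realType} {n : nat}.
Variable a : R.

(* Worker 0 owns the even links of the chain and worker 1 the odd ones; the
   factor n compensates the mean over the workers. *)
Definition worker_wt (i : 'I_n) (j : nat) : R :=
  if odd j == i :> nat then n%:R * a else 0.

(** Consecutive links have opposite parities: after using its own link, a worker faces one that it
    does not own. This is what stops its local gradient calls. *)
Lemma worker_wt_next i m : worker_wt i (m + (worker_wt i m != 0)%R)%N = 0.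
Proof.
have [wm|] := eqVneq (worker_wt i m) 0; first by rewrite addn0.
rewrite addn1 /worker_wt oddS.
by case: (nat_of_ord i) => [|[|k]]; case: (odd m); rewrite /= ?eqxx.
Qed.

Lemma worker_wt_idle (i : 'I_n) m : (2 <= i)%N -> worker_wt i m = 0.
Proof. by move=> i2; rewrite /worker_wt; case: eqP => // E; move: i2; rewrite -E; case: odd. Qed.

Lemma worker_wt_mean j : (2 <= n)%N -> a = n%:R^-1 * \sum_(i < n) worker_wt i j.
Proof.
move=> n2; have jn : (odd j < n)%N by rewrite (leq_trans _ n2)//; case: odd.
rewrite (bigD1 (Ordinal jn))//= big1 => [|i ij]; last first.
  rewrite /worker_wt; case: eqP => // E; move: ij; rewrite -val_eqE/= -E eqxx//.
by rewrite addr0 /worker_wt/= eqxx mulKf// pnatr_eq0 -lt0n (leq_trans _ n2).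
Qed.

End worker_split.

Lemma chain_mean (R : realType) (T n : nat) (lam a : R) (x : 'rV[R]_T) :
  (2 <= n)%N ->
  chain lam (fun=> a) x = n%:R^-1 * \sum_(i < n) chain lam (worker_wt a i) x.
Proof.
move=> n2; rewrite /chain exchange_big /= mulr_sumr; apply: eq_bigr => j _.
by rewrite -mulr_suml mulrA -worker_wt_mean.
Qed.

(** * Progress of the support along a run *)

Section progress.
Context {R : realType} {n T : nat}.
Variables (A : forall d, algorithm R n d) (lam a p : R) (b : nat -> 'I_n -> bool).
Hypotheses (lam0 : 0 < lam) (zrA : zero_respecting A).

(** The extra 1 pays for the coordinate that worker 0 can find before any successful message, as it
    owns link 0. *)
Definition prog_bound (k : nat) : nat :=
  (\sum_(j < k) \sum_(i < n | (i < 2)%N) b j i).+1.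

Lemma prog_boundS k :
  prog_bound k.+1 = (prog_bound k + \sum_(i < n | (i < 2)%N) b k i)%N.
Proof. by rewrite /prog_bound big_ord_recr. Qed.

Lemma prog_bound_leS k : (prog_bound k <= prog_bound k.+1)%N.
Proof. by rewrite prog_boundS leq_addr. Qed.

Lemma prog_bound_ltS k (i : 'I_n) : (i < 2)%N -> b k i -> (prog_bound k < prog_bound k.+1)%N.
Proof.
by move=> i2 bi; rewrite prog_boundS (bigD1 i)//= bi -[X in (X < _)%N]addn0 ltn_add2l.
Qed.

Let f (i : 'I_n) : 'rV[R]_T -> R := chain lam (worker_wt a i).
Let c k i : 'rV[R]_T -> 'rV[R]_T := drop_compressor p (b k i).
Let x := run_x (A T) f c.
Let s := run_s (A T) f c.
Let sbar := run_sbar (A T) f c.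
Let g := run_g (A T) f c.

Let below (m : nat) : set 'I_T := [set i | (i < m)%N].

Let below_le m m' : (m <= m')%N -> below m `<=` below m'.
Proof. by move=> mm' i /= im; exact: leq_trans mm'. Qed.

(* P bounds what worker i has received: what it can compute by itself from
   there extends the reach by at most one, namely when it owns the link P. *)
Let invariant (k : nat) :=
  (forall j l, (j < k)%N -> supp (g j l) `<=` below (prog_bound k)) /\
  forall i, exists P, (forall j, (j < k)%N -> supp (sbar j i) `<=` below P) /\
    (P + (worker_wt a i P != 0)%R <= prog_bound k)%N.

Let differentiable_f i y : differentiable (f i) y.
Proof. exact: chain_differentiable. Qed.

Let invariantP k : invariant k.
Proof.
elim: k => [|k [gk sbark]].
  split=> [//|i]; exists 0%N; split=> //; rewrite add0n /prog_bound big_ord0.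
  exact: leq_b1.
have sk i : supp (s k i) `<=` below (prog_bound k).
  have [_ H _] := @zrA T f c differentiable_f k i.
  by move=> y /H [j /= jk [l _]]; exact: gk.
(* The messages of round [k] are treated first, since [g k] already depends on them. *)
have sbarS i : exists P,
    (forall j, (j < k.+1)%N -> supp (sbar j i) `<=` below P) /\
    (P + (worker_wt a i P != 0)%R <= prog_bound k.+1)%N.
  have [P [sP PN]] := sbark i; case: (boolP (b k i)) => bi.
    exists (prog_bound k); split=> [j|].
      rewrite ltnS leq_eqVlt => /predU1P[->|jk].
        rewrite /sbar run_sbarE -/s /c /drop_compressor bi.
        apply: subset_trans (sk i) => y; rewrite /supp/= mxE.
        by apply: contra => /eqP ->; rewrite mulr0.
      apply: subset_trans (sP j jk) _; apply: below_le.
      by apply: leq_trans PN; exact: leq_addr.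
    (* For an active worker this very success raises [prog_bound] and pays for its own link; the
       other workers own none. *)
    have [i2|i2] := ltnP i 2; last by rewrite worker_wt_idle// eqxx addn0 prog_bound_leS.
    apply: leq_trans (prog_bound_ltS i2 bi).
    by rewrite -addn1 leq_add2l leq_b1.
  (* A failure transmits 0, so the old [P] still works. *)
  exists P; split=> [j|]; last exact: leq_trans (prog_bound_leS k).
  rewrite ltnS leq_eqVlt => /predU1P[->|jk]; last exact: sP.
  rewrite /sbar run_sbarE /c /drop_compressor (negbTE bi) => y.
  by rewrite /supp/= mxE eqxx.
split=> [j l|i]; last exact: sbarS.
rewrite ltnS leq_eqVlt => /predU1P[->|jk]; last first.
  by apply: subset_trans (gk j l jk) _; apply: below_le; exact: prog_bound_leS.
have [P [sP PN]] := sbarS l.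
have [_ _ [ghat [ghatP gP]]] := @zrA T f c differentiable_f k l.
apply: subset_trans gP _ => y [m _] my; apply: (below_le PN).
(* Strong induction over the oracle points: each is supported below [P], plus one if the worker owns
   link [P], and by [worker_wt_next] a gradient taken there adds nothing. *)
move: y my; elim/ltn_ind: m => m IH y /ghatP [[t /= tk]|[r /= rm]].
  by move=> /(sP t tk); apply: below_le; exact: leq_addr.
rewrite /f grad_chain// => /(chain_grad_supp (IH r rm)).
by rewrite worker_wt_next eqxx addn0.
Qed.

Lemma supp_run_x k : (0 < n)%N ->
  supp (x k) `<=` [set i | (i < prog_bound k)%N].
Proof.
move=> n0; have [H _ _] := @zrA T f c differentiable_f k (Ordinal n0).
have [gk _] := invariantP k.
by move=> y /H [j /= jk [l _]]; exact: gk.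
Qed.

End progress.

(** * Dependence on finitely many coins, and measurability *)

Lemma protocol_history_ext (R : realType) (n d : nat) (A : algorithm R n d)
    (f : 'I_n -> 'rV[R]_d -> R) (c c' : nat -> 'I_n -> 'rV[R]_d -> 'rV[R]_d) k :
  (forall j, (j < k)%N -> c j = c' j) ->
  protocol_history A f c k = protocol_history A f c' k.
Proof.
elim: k => // k IH cc' /=; rewrite cc'// IH// => j jk.
by apply: cc'; exact: ltnW.
Qed.

Lemma run_x_ext (R : realType) (n d : nat) (A : algorithm R n d)
    (f : 'I_n -> 'rV[R]_d -> R) (c c' : nat -> 'I_n -> 'rV[R]_d -> 'rV[R]_d) k :
  (forall j, (j < k)%N -> c j = c' j) -> run_x A f c k = run_x A f c' k.
Proof.
move=> cc'; rewrite /run_x; congr server_point; apply/funext => j; apply/funext => l.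
rewrite /run_g (protocol_history_ext _ _ (c' := c'))// => m mj; apply: cc'.
by rewrite (leq_trans mj).
Qed.

(** [H] is arbitrary: there are finitely many truth tables, and each is a finite intersection of
    coin events. *)
Lemma measurable_ffun_bool {R : realType} {dO : measure_display}
    {Omega : measurableType dO} (I : finType) (X : I -> Omega -> bool)
    (H : {ffun I -> bool} -> R) :
  (forall i, measurable_fun [set: Omega] (X i)) ->
  measurable_fun [set: Omega] (fun w => H [ffun i => X i w]).
Proof.
move=> mX _ Y mY; rewrite setTI.
rewrite (_ : _ @^-1` _ = \bigcup_(v in [set v | Y (H v)]) \bigcap_i (X i @^-1` [set v i])).
  apply: fin_bigcup_measurable; first exact: finite_finset.
  move=> v _; apply: fin_bigcap_measurable => [|i _]; first exact: finite_finset.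
  by rewrite -[X in measurable X]setTI; apply: mX.
apply/seteqP; split=> w /=.
  by move=> Yw; exists [ffun i => X i w] => // i _ /=; rewrite ffunE.
move=> [v /= Yv vw]; rewrite (_ : [ffun _ => _] = v)//.
by apply/ffunP => i; rewrite ffunE; exact: vw.
Qed.

(** * Expectation of the progress bound *)

Section expected_progress.
Context {R : realType} {dO : measure_display} {Omega : measurableType dO}.
Variables (P : probability Omega R) (n : nat) (b : nat -> 'I_n -> Omega -> bool).
Variable p : R.
Hypotheses (mb : forall j i, measurable_fun [set: Omega] (b j i))
  (pb : forall j i, P (b j i @^-1` [set true]) = p%:E).

Let mb1 j i : measurable (b j i @^-1` [set true]).
Proof. by rewrite -[X in measurable X]setTI; apply: mb. Qed.

Let indicE j i w : (b j i w : nat)%:R = \1_(b j i @^-1` [set true]) w :> R.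
Proof. by rewrite indicE; congr ((nat_of_bool _)%:R); apply/idP/idP; rewrite in_setE. Qed.

Let mbR j i : measurable_fun [set: Omega] (fun w => (b j i w : nat)%:R : R).
Proof. by under eq_fun do rewrite indicE; exact: measurable_indic. Qed.

Let pairs k := seq.filter (fun t : 'I_k * 'I_n => (t.2 < 2)%N) (index_enum _).

Let progR k w : (prog_bound (fun j i => b j i w) k)%:R =
  1 + \sum_(t <- pairs k)
        (b t.1 t.2 w : nat)%:R :> R.
Proof.
by rewrite /prog_bound -natr1 addrC pair_big_dep /= natr_sum big_filter.
Qed.

Lemma measurable_prog_bound k : measurable_fun [set: Omega]
  (fun w => (prog_bound (fun j i => b j i w) k)%:R : R).
Proof.
under eq_fun do rewrite progR; apply: measurable_funD => //.
exact: measurable_sum.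
Qed.

(** By linearity: each round contributes two coins of mean [p], those of workers 0 and 1. *)
Lemma expectation_prog_bound k : (2 <= n)%N ->
  'E_P[fun w => (prog_bound (fun j i => b j i w) k)%:R : R]%E
  = (1 + 2 * k%:R * p)%:E.
Proof.
move=> n2; rewrite unlock; under eq_integral do rewrite progR EFinD -sumEFin.
rewrite ge0_integralD//; last 2 first.
- by move=> w _; apply: sume_ge0 => t _; rewrite lee_fin.
- by apply: emeasurable_sum => t; exact/measurable_EFinP.
rewrite integral_cst// mul1e [X in (X + _)%E](_ : _ = 1%E); last exact: probability_setT.
rewrite ge0_integral_sum//=; last first.
- by move=> t; exact/measurable_EFinP.
rewrite EFinD; congr (_ + _)%E.
rewrite (eq_bigr (fun=> p%:E)) => [|t _]; last first.
  under eq_integral do rewrite indicE.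
  by rewrite integral_indic// setIT; exact: pb.
rewrite sumEFin big_filter -(pair_big_dep xpredT (fun _ (i : 'I_n) => (i < 2)%N) (fun _ _ => p)) /=.
have -> : \sum_(i < n | (i < 2)%N) p = 2 * p.
  case: n n2 => [|[|m]]// _; rewrite big_mkcond 2!big_ord_recl big1 => [|i _]; last by [].
  by rewrite /= addr0 -mulr2n mulr_natl.
by rewrite sumr_const card_ord -[X in X%:E]mulr_natr mulrAC.
Qed.

(** The progress term is added rather than subtracted, so that only nonnegative functions are
    integrated and [sq] may have infinite expectation. *)
Lemma expectation_lower_bound (sq : Omega -> R) (G c : R) k : (2 <= n)%N ->
  measurable_fun [set: Omega] sq -> (forall w, 0 <= sq w) -> 0 <= G -> 0 <= c ->
  (forall w, G <= sq w + c * (prog_bound (fun j i => b j i w) k)%:R) ->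
  (G%:E <= 'E_P[sq] + (c * (1 + 2 * k%:R * p))%:E)%E.
Proof.
move=> n2 msq sq0 G0 c0 Gsq; rewrite EFinM -(expectation_prog_bound k n2) unlock.
rewrite -ge0_integralZl_EFin//; last first.
  exact/measurable_EFinP/measurable_prog_bound.
rewrite -ge0_integralD//.
- rewrite -[leLHS]mule1 -(@probability_setT _ _ _ P) -integral_cst//.
  apply: ge0_le_integral => //.
  + apply: emeasurable_funD; first exact/measurable_EFinP.
    by apply: measurable_funeM; apply/measurable_EFinP/measurable_prog_bound.
  + by move=> w _; rewrite -EFinM -EFinD lee_fin.
- by move=> w _; rewrite lee_fin.
- exact/measurable_EFinP.
- by move=> w _; rewrite -EFinM lee_fin mulr_ge0.
- by apply: measurable_funeM; apply/measurable_EFinP/measurable_prog_bound.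
Qed.

End expected_progress.

(** * The lower bound for the chain and the choice of parameters *)

Lemma chain_smooth_class (R : realType) (T : nat) (lam a L delta0 : R) :
  0 < lam -> 0 <= a -> 57 * a / lam ^+ 2 <= L -> a * T.+1%:R <= delta0 ->
  smooth_class delta0 L (@chain R T lam (fun=> a)).
Proof.
move=> lam0 a0 aL adelta; split=> [x|x y|].
- exact: chain_differentiable.
- rewrite !grad_chain//; apply: le_trans (chain_grad_lip lam0 _ _ a0) _.
  by rewrite ler_wpM2r// sqrtr_ge0.
- have lbE : ((- (a * T.+1%:R))%:E <= ereal_inf (range (EFin \o @chain R T lam (fun=> a))))%E.
    by apply: le_ereal_inf_tmp => _ [x _ <-]; rewrite lee_fin chain_ge.
  apply: (@le_trans _ _ (0%:E - (- (a * T.+1%:R))%:E)%E).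
    by apply: leeB => //; rewrite lee_fin chain0_le0.
  by rewrite -EFinB lee_fin sub0r opprK.
Qed.

Lemma hard_instance_lower_bound (R : realType) (n T k : nat)
    (A : forall d, algorithm R n d) (lam a p G : R)
    (dO : measure_display) (Omega : measurableType dO) (P : probability Omega R)
    (b : nat -> 'I_n -> Omega -> bool) :
  zero_respecting A -> (2 <= n)%N -> (0 < T)%N -> 0 < lam -> 0 <= a ->
  (forall j i, measurable_fun [set: Omega] (b j i)) ->
  (forall j i, P (b j i @^-1` [set true]) = p%:E) ->
  G = (a / lam / 4) ^+ 2 ->
  let sqnorm w := enorm (grad (chain lam (fun=> a))
    (run_x (A T) (fun i => chain lam (worker_wt a i))
       (fun j i => drop_compressor p (b j i w)) k)) ^+ 2 in
  measurable_fun [set: Omega] sqnorm /\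
  (G%:E <= 'E_P[sqnorm] + (G / T%:R * (1 + 2 * k%:R * p))%:E)%E.
Proof.
move=> zrA n2 T0 lam0 a0 mb pb GE sqnorm.
have G0 : 0 <= G by rewrite GE sqr_ge0.
have T0' : 0 < T%:R :> R by rewrite ltr0n.
(* The table of the first [k] rounds is padded with failures; by [run_x_ext] the padding does not
   affect the point of round [k]. *)
pose bk (v : {ffun 'I_k * 'I_n -> bool}) (j : nat) (i : 'I_n) : bool :=
  if insub j is Some j' then v (j', i) else false.
have msq : measurable_fun [set: Omega] sqnorm.
  (* The algorithm need not be measurable, but the first k iterations depend
     on finitely many coins only. *)
  pose H v := enorm (grad (@chain R T lam (fun=> a))
    (run_x (A T) (fun i => chain lam (worker_wt a i))
       (fun j i => drop_compressor p (bk v j i)) k)) ^+ 2.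
  rewrite (_ : sqnorm = fun w => H [ffun t : 'I_k * 'I_n => b t.1 t.2 w]); last first.
    apply/funext => w; rewrite /sqnorm /H.
    congr (enorm (grad _ _) ^+ 2); apply: run_x_ext => j jk.
    by apply/funext => i; rewrite /bk insubT ffunE.
  by apply: measurable_ffun_bool => t; exact: mb.
split=> //; apply: expectation_lower_bound => //; [by move=> w; exact: sqr_ge0|exact: divr_ge0|].
move=> w.
set N := prog_bound _ _.
(* If [N] reaches [T], the term [G / T * N] alone is at least [G]; otherwise the squared gradient
   norm is. *)
have [NT|NT] := ltnP N T; last first.
  rewrite ler_wpDl ?sqr_ge0// -mulrA ler_peMr// mulrC ler_pdivlMr// mul1r.
  by rewrite ler_nat.
rewrite ler_wpDr ?mulr_ge0 ?divr_ge0 ?(ltW T0')// GE /sqnorm grad_chain//.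
apply: (@chain_grad_ge R T lam lam0 a _ N) => //.
by apply: supp_run_x => //; exact: ltnW.
Qed.

Theorem theoremG5 (R : realType) :
  exists cbar chat : R, [/\ 0 < cbar, 0 < chat &
  forall (omega L delta0 eps : R) (n : nat),
    0 <= omega -> 0 < L -> 0 < delta0 -> 0 < eps -> (2 <= n)%N ->
    cbar * eps < L * delta0 ->
  forall A : (forall d : nat, algorithm R n d), zero_respecting A ->
  exists (d : nat) (f : 'rV[R]_d -> R) (fi : 'I_n -> 'rV[R]_d -> R),
    [/\ smooth_class delta0 L f,
        forall i x, differentiable (fi i) x,
        forall x, f x = n%:R^-1 * \sum_(i < n) fi i x &
    exists (dS : measure_display) (S : measurableType dS)
           (nu : probability S R) (C : S -> 'rV[R]_d -> 'rV[R]_d)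
           (dO : measure_display) (Omega : measurableType dO)
           (P : probability Omega R) (xi : nat -> 'I_n -> Omega -> S),
      [/\ unbiased_compressor nu omega C,
          iid_seeds P nu (fun t : nat * 'I_n => xi t.1 t.2) &
          forall k : nat, k%:R <= chat * ((omega + 1) * L * delta0 / eps) ->
            let sqnorm (w : Omega) :=
              enorm (grad f (run_x (A d) fi (fun m i => C (xi m i w)) k)) ^+ 2 in
            measurable_fun [set: Omega] sqnorm /\
            (eps%:E < 'E_P[sqnorm])%E]]].
Proof.
(* The factor 60 * 64 comes from [a]; the factor 8 makes [T] exceed 6 and bounds [k * p] by
   [tau / 8]. *)
exists (60 * 64 * 8), (60 * 64 * 8)^-1; split; [lra|by rewrite invr_gt0; lra|].
move=> omega L delta0 eps n omega0 L0 delta0_gt0 eps0 n2 big A zrA.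
pose tau := L * delta0 / (60 * 64 * eps).
have tau8 : 8 < tau by rewrite ltr_pdivlMr ?mulr_gt0 //; lra.
(* The chain has [T.+1] links, each lowering the value by at most [a], and [a * tau = delta0]. *)
pose T := (Num.trunc tau).-1.
have /andP[tauT Ttau] : (T.+1%:R <= tau < T.+2%:R).
  rewrite /T prednK; first by apply: truncn_itv; lra.
  by rewrite truncn_gt0; lra.
have T7 : 6 < T%:R :> R by rewrite -!natr1 in Ttau; lra.
have T0 : (0 < T)%N by rewrite -(ltr0n R); lra.
pose r := Num.sqrt eps.
have r0 : 0 < r by rewrite sqrtr_gt0.
have r2 : r ^+ 2 = eps by rewrite sqr_sqrtr// ltW.
(* These values solve [60 * a / lam ^+ 2 = L], with 57 rounded up to 60, and
   [(a / lam / 4) ^+ 2 = 4 * eps]; the factor 4 leaves room for the loss in the averaging. *)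
pose lam := 60 * 8 * r / L; pose a := 60 * 64 * eps / L.
have lam0 : 0 < lam by rewrite divr_gt0// mulr_gt0.
have a0 : 0 < a by rewrite divr_gt0// mulr_gt0.
pose p := (omega + 1)^-1.
have p0 : 0 < p by rewrite invr_gt0; lra.
have p1 : p <= 1 by rewrite invf_le1; lra.
have GE : 4 * eps = (a / lam / 4) ^+ 2.
  by rewrite /a /lam -r2; field; rewrite !gt_eqF.
exists T, (chain lam (fun=> a)), (fun i : 'I_n => chain lam (worker_wt a i)).
split=> [|i x|x|].
- apply: chain_smooth_class => //; first exact: ltW.
    rewrite (_ : 57 * a / lam ^+ 2 = 57 / 60 * L); last first.
      by rewrite /a /lam -r2; field; rewrite !gt_eqF.
    lra.
  rewrite (_ : delta0 = a * tau); first by rewrite ler_pM2l.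
  by rewrite /a /tau; field; rewrite !gt_eqF.
- exact: chain_differentiable.
- exact: chain_mean.
pose xi (k : nat) (i : 'I_n) := shift_seed (coin p) (coin_shift p) (pickle (k, i)).
have iid : iid_seeds (@unit_law R) (bernoulli_prob p) (fun t : nat * 'I_n => xi t.1 t.2).
  have := iid_shift_seeds (measurable_coin p) (measurable_coin_shift p)
    (coin_shift_law p0 p1) (nat * 'I_n)%type.
  by congr iid_seeds; apply/funext => -[].
exists _, bool, (bernoulli_prob p), (drop_compressor p).
exists _, (measurableTypeR R), (@unit_law R), xi.
split=> //; first exact: drop_compressor_unbiased.
move=> k kle.
have [mxi law _] := iid.
have pxi j i : unit_law (xi j i @^-1` [set true]) = p%:E.
  rewrite (law (j, i))//; apply: etrans (bernoulli_probE _ _) _.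
    by rewrite p1 ltW.
  by rewrite /dirac !indicE mem_set//= memNset//= mule1 mule0 adde0.
have [msq lb] := @hard_instance_lower_bound R n T k A lam a p (4 * eps) _ _
  (@unit_law R) xi zrA n2 T0 lam0 (ltW a0) (fun j i => mxi (j, i)) pxi GE.
split; first exact: msq.
(* If the expectation were at most [eps], then [4 * eps] would be at most [eps] plus a loss, shown
   below to be less than [3 * eps]. *)
rewrite ltNge; apply/negP => ub.
have := le_trans lb (leeD2r _ ub).
rewrite -EFinD lee_fin leNgt => /negP; apply.
have -> : 4 * eps / T%:R * (1 + 2 * k%:R * p) = eps * (4 * ((1 + 2 * k%:R * p) / T%:R)).
  by ring.
have kp : k%:R * p <= tau / 8.
  rewrite /p ler_pdivrMr; last by lra.
  apply: le_trans kle _; rewrite /tau le_eqVlt; apply/orP; left; apply/eqP.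
  by field; rewrite gt_eqF.
(* The numerator is at most [1 + tau / 4], hence below [3 / 2 + T / 4], and [T] exceeds 6. *)
have : (1 + 2 * k%:R * p) / T%:R < 3 / 4.
  rewrite ltr_pdivrMr; last by lra.
  by rewrite -!natr1 in Ttau; lra.
by move=> H; nra.
Qed.
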